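(* Let $T=T(\mathbf u,\mathbf v)\in\mathcal T$ be $n\times n$, let $\mathbf u_k,\mathbf v_k$ ($k=1,\dots,n$) be the exact vectors of the downdating recursion for $T$ started from $\mathbf u_1=\mathbf u$, $\mathbf v_1=\mathbf v$, and let $\tilde{\mathbf u}_k,\tilde{\mathbf v}_k$ ($k=1,\dots,n$) be computed vectors, depending on the machine precision $\epsilon$, with $\tilde{\mathbf u}_k=\mathbf u_k+O(\epsilon)$ and $\tilde{\mathbf v}_k=\mathbf v_k+O(\epsilon)$. Assume that there are matrices $G_k\in\mathbb R^{n\times n}$ with $$\tilde{\mathbf u}_{k+1}\tilde{\mathbf u}_{k+1}^T-\tilde{\mathbf v}_{k+1}\tilde{\mathbf v}_{k+1}^T=Z\tilde{\mathbf u}_k\tilde{\mathbf u}_k^TZ^T-\tilde{\mathbf v}_k\tilde{\mathbf v}_k^T+\epsilon G_k+O(\epsilon^2),\qquad k=1,\dots,n-1,$$ and a positive constant $c_m$ such that, for $k=1,\dots,n-1$ and $j=0,\dots,n-1$, $$\|Z_jG_kZ_j^T\|\le c_m\left(\|Z_{j+1}\mathbf u_k\|^2+\|Z_j\mathbf v_k\|^2+\|Z_j\mathbf u_{k+1}\|^2+\|Z_j\mathbf v_{k+1}\|^2\right).$$ Let $\tilde U=\sum_{k=1}^n\mathbf e_k\tilde{\mathbf u}_k^T$. Then $$\|T-\tilde U^T\tilde U\|\le 2n\|\mathbf u\|\left(\|\tilde{\mathbf u}_1-\mathbf u\|+\|\tilde{\mathbf v}_1-\mathbf v\|\right)+4\epsilon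 c_m\sum_{j=0}^{n-1}\mathrm{Tr}(Z_jTZ_j^T)+O(\epsilon^2).$$
   Context: All vectors lie in $\mathbb R^n$ and all matrices in $\mathbb R^{n\times n}$ unless indicated; $\|\cdot\|$ is the Euclidean norm of vectors and the induced operator norm of matrices; $\mathbf e_k$ is the $k$th standard unit vector. $Z=\sum_{i=1}^{n-1}\mathbf e_{i+1}\mathbf e_i^T$ is the shift-down matrix, $Z_0=I$ and $Z_k=Z^k$ for $k>0$. The class $\mathcal T$ consists of the symmetric positive definite matrices $T$ for which there are vectors $\mathbf u,\mathbf v\in\mathbb R^n$ (called generators; one writes $T=T(\mathbf u,\mathbf v)$) with $T-ZTZ^T=\mathbf u\mathbf u^T-\mathbf v\mathbf v^T$ and $\mathbf v^T\mathbf e_1=0$. Exact downdating recursion: given $T=T(\mathbf u,\mathbf v)\in\mathcal T$, set $\mathbf u_1=\mathbf u$, $\mathbf v_1=\mathbf v$, and for $k=1,\dots,n-1$ set $\sin\theta_k=\mathbf e_{k+1}^T\mathbf v_k/\mathbf e_k^T\mathbf u_k$, $\cos\theta_k=\sqrt{1-\sin^2\theta_k}$, and $$\mathbf u_{k+1}=(Z\mathbf u_k-\sin\theta_k\,\mathbf v_k)/\cos\theta_k,\qquad \mathbf v_{k+1}=(\mathbf v_k-\sin\theta_k\,Z\mathbf u_k)/\cos\theta_k .$$ For $T\in\mathcal T$ one has $|\mathbf e_k^T\mathbf u_k|>|\mathbf e_{k+1}^T\mathbf v_k|$ for each $k=1,\dots,n-1$, so this is well defined. These vectors satisfy $\mathbf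 u_{k+1}\mathbf u_{k+1}^T-\mathbf v_{k+1}\mathbf v_{k+1}^T=Z\mathbf u_k\mathbf u_k^TZ^T-\mathbf v_k\mathbf v_k^T$, $\mathbf e_j^T\mathbf u_k=0$ for $j<k$, and $\mathbf e_j^T\mathbf v_k=0$ for $j\le k$. Asymptotic convention (first order analysis): the problem ($n$, $T$, $\mathbf u$, $\mathbf v$) is fixed and $\epsilon\to0+$. The computed vectors $\tilde{\mathbf u}_k,\tilde{\mathbf v}_k$ and the matrices $G_k$ may depend on $\epsilon$; $c_m$ does not depend on $\epsilon,j,k$. Constants in the $O$ terms may depend on the fixed problem (including $n$). In the perturbed downdating relation the term $O(\epsilon^2)$ is a matrix whose elements are bounded by a constant multiple of $\epsilon^2\|G_k\|$. *)

(* Defs.v *)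
From HB Require Import structures.
From mathcomp Require Import all_boot all_order all_algebra.
From mathcomp Require Import all_classical all_reals all_analysis.

Set Implicit Arguments.
Unset Strict Implicit.
Unset Printing Implicit Defensive.

Import Order.TTheory GRing.Theory Num.Theory.
Import numFieldNormedType.Exports.

Local Open Scope classical_set_scope.
Local Open Scope ring_scope.

(* Vectors are columns, and coordinates are numbered from 1 to n: the nonzero
   entry of [unitv R n k] sits at the ordinal of value k - 1. *)
Definition unitv (R : realType) (n k : nat) : 'cV[R]_n :=
  \col_i (i.+1 == k)%:R.

Definition entry (R : realType) (n k : nat) (x : 'cV[R]_n) : R :=
  ((unitv R n k)^T *m x) 0 0.

(* The norm that MathComp-Analysis puts on matrices and vectors is the max
   norm, hence the two definitions below. *)
Definition enorm (R : realType) (n : nat) (x : 'cV[R]_n) : R :=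
  Num.sqrt (\sum_i x i 0 ^+ 2).

Definition opnorm (R : realType) (n : nat) (A : 'M[R]_n) : R :=
  sup [set enorm (A *m x) | x in [set x : 'cV[R]_n | enorm x <= 1]].

Definition shiftmx (R : realType) (n : nat) : 'M[R]_n :=
  \sum_(1 <= i < n) unitv R n i.+1 *m (unitv R n i)^T.

Definition shiftmx_pow (R : realType) (n k : nat) : 'M[R]_n := shiftmx R n ^+ k.

Definition posdefmx (R : realType) (n : nat) (T : 'M[R]_n) : Prop :=
  T^T = T /\ forall x : 'cV[R]_n, x != 0 -> 0 < (x^T *m T *m x) 0 0.

(* T = T(u, v) is an element of the class of matrices under study. *)
Definition generated_by (R : realType) (n : nat)
    (T : 'M[R]_n) (u v : 'cV[R]_n) : Prop :=
  [/\ posdefmx T,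
      T - shiftmx R n *m T *m (shiftmx R n)^T = u *m u^T - v *m v^T
    & (v^T *m unitv R n 1) 0 0 = 0].

(* Only the terms of index 1, ..., n of the sequences are constrained. *)
Definition downdating (R : realType) (n : nat) (u v : 'cV[R]_n)
    (us vs : nat -> 'cV[R]_n) : Prop :=
  [/\ us 1 = u, vs 1 = v &
      forall k : nat, (1 <= k < n)%N ->
      let sin_k := entry k.+1 (vs k) / entry k (us k) in
      let cos_k := Num.sqrt (1 - sin_k ^+ 2) in
      us k.+1 = cos_k^-1 *: (shiftmx R n *m us k - sin_k *: vs k) /\
      vs k.+1 = cos_k^-1 *: (vs k - sin_k *: (shiftmx R n *m us k))].

(* Main.v *)
Require Import Defs.
From HB Require Import structures.
From mathcomp Require Import all_boot all_order all_algebra.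
From mathcomp Require Import all_classical all_reals all_analysis.
From mathcomp Require Import zify ring lra.
Import Order.TTheory GRing.Theory Num.Theory.
Import numFieldNormedType.Exports.
Local Open Scope classical_set_scope.
Local Open Scope ring_scope.

(* Write Zj for the j-th power of Z. The tails S_k = sum_(i >= k) u_i u_i^T of
   the exact recursion are successive Schur complements of T, which keeps every
   rotation angle well defined and gives T = sum_k u_k u_k^T, Z u_n = 0 and
   v_n = 0. Taking traces in S_k - Z S_k Z^T = u_k u_k^T - v_k v_k^T conjugated
   by Zj yields |Zj v_k| <= |Zj u_k|, so the bounds on the G_k sum to at most
   4 cm Tr(Zj T Zj^T).  For D = T - Ut^T Ut, summing the perturbed relation
   over k expresses D - Z D Z^T through the initial errors, the G_k and
   quadratically small terms, and D = sum_j Zj (D - Z D Z^T) Zj^T because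
   Z^n = 0. *)

(** * Euclidean and operator norms *)

Section Norms.
Context {R : realType} {n : nat}.
Implicit Types (x y : 'cV[R]_n) (A B : 'M[R]_n) (a c : R).

Lemma enorm_ge0 x : 0 <= enorm x.
Proof. exact: sqrtr_ge0. Qed.

Lemma sqr_enorm x : enorm x ^+ 2 = \sum_i x i 0 ^+ 2.
Proof. by rewrite sqr_sqrtr// sumr_ge0// => i _; rewrite sqr_ge0. Qed.

Lemma mxtrace_sqr_enorm x : \tr (x *m x^T) = enorm x ^+ 2.
Proof.
rewrite sqr_enorm; apply: eq_bigr => i _.
by rewrite !mxE big_ord1 !mxE expr2.
Qed.

Lemma ler_enorm_sqr x y : enorm x ^+ 2 <= enorm y ^+ 2 -> enorm x <= enorm y.
Proof. by rewrite ler_sqr ?nnegrE ?enorm_ge0. Qed.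

Lemma enorm0 : enorm (0 : 'cV[R]_n) = 0.
Proof.
apply/eqP; rewrite -sqrf_eq0 sqr_enorm big1// => i _.
by rewrite mxE expr0n.
Qed.

Lemma enormZ a x : enorm (a *: x) = `|a| * enorm x.
Proof.
rewrite /enorm -sqrtr_sqr -sqrtrM ?sqr_ge0//; congr Num.sqrt.
by rewrite mulr_sumr; apply: eq_bigr => i _; rewrite mxE exprMn.
Qed.

Lemma enormN x : enorm (- x) = enorm x.
Proof. by rewrite -scaleN1r enormZ normrN1 mul1r. Qed.

Lemma entry_le_enorm x i : `|x i 0| <= enorm x.
Proof.
rewrite -sqrtr_sqr ler_wsqrtr// (bigD1 i)//= lerDl sumr_ge0// => j _.
exact: sqr_ge0.
Qed.

Lemma enorm_eq0 x : enorm x = 0 -> x = 0.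
Proof.
move=> x0; apply/matrixP => i j; rewrite ord1 mxE; apply/eqP.
by rewrite -normr_le0 -x0 entry_le_enorm.
Qed.

(** For nonzero vectors, the sum of squares of the entries of [enorm y *: x - enorm x *: y] is a
    positive multiple of the gap between the two sides. *)
Lemma cauchy_schwarz x y : \sum_i x i 0 * y i 0 <= enorm x * enorm y.
Proof.
have [/enorm_eq0 ->|x0] := eqVneq (enorm x) 0.
  by rewrite enorm0 mul0r big1// => i _; rewrite mxE mul0r.
have [/enorm_eq0 ->|y0] := eqVneq (enorm y) 0.
  by rewrite enorm0 mulr0 big1// => i _; rewrite mxE mulr0.
have xp : 0 < enorm x by rewrite lt_neqAle eq_sym x0 enorm_ge0.
have yp : 0 < enorm y by rewrite lt_neqAle eq_sym y0 enorm_ge0.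
have : 0 <= \sum_i (x i 0 * enorm y - y i 0 * enorm x) ^+ 2.
  by rewrite sumr_ge0// => i _; rewrite sqr_ge0.
have -> : \sum_i (x i 0 * enorm y - y i 0 * enorm x) ^+ 2 =
    2 * (enorm x * enorm y) * (enorm x * enorm y - \sum_i x i 0 * y i 0).
  transitivity ((\sum_i x i 0 ^+ 2) * enorm y ^+ 2
      + (\sum_i y i 0 ^+ 2) * enorm x ^+ 2
      - 2 * (enorm x * enorm y) * \sum_i x i 0 * y i 0).
    rewrite !mulr_suml mulr_sumr -big_split -sumrB.
    by apply: eq_bigr => i _ /=; ring.
  by rewrite -!sqr_enorm; ring.
by rewrite pmulr_rge0 ?subr_ge0// !mulr_gt0.
Qed.

Lemma ler_enormD x y : enorm (x + y) <= enorm x + enorm y.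
Proof.
rewrite -ler_sqr ?nnegrE ?addr_ge0 ?enorm_ge0// sqrrD !sqr_enorm.
have -> : \sum_i (x + y) i 0 ^+ 2 = \sum_i x i 0 ^+ 2
    + (\sum_i x i 0 * y i 0) *+ 2 + \sum_i y i 0 ^+ 2.
  rewrite -sumrMnl -!big_split; apply: eq_bigr => i _ /=.
  by rewrite mxE sqrrD.
by rewrite lerD2r lerD2l lerMn2r cauchy_schwarz.
Qed.

Lemma ler_enorm_sum (I : Type) (s : seq I) (F : I -> 'cV[R]_n) :
  enorm (\sum_(i <- s) F i) <= \sum_(i <- s) enorm (F i).
Proof.
apply: (big_ind2 (fun x c => enorm x <= c)) => //.
- by rewrite enorm0.
- move=> x1 a1 x2 a2 h1 h2; apply: le_trans (ler_enormD _ _) _.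
  exact: lerD.
Qed.

Lemma enorm_delta_le1 i : enorm (delta_mx i 0 : 'cV[R]_n) <= 1.
Proof.
rewrite -(@ler_sqr _ _ 1) ?nnegrE ?enorm_ge0// sqr_enorm.
rewrite (bigD1 i)//= big1 => [|j /negPf ji].
  by rewrite mxE !eqxx addr0 expr1n.
by rewrite mxE ji expr0n.
Qed.

Lemma ler_opnorm A c : (forall x, enorm x <= 1 -> enorm (A *m x) <= c) ->
  opnorm A <= c.
Proof.
move=> Ac; apply: ge_sup.
  by exists (enorm (A *m 0)), 0 => //=; rewrite enorm0 ler01.
by move=> _ [x x1 <-]; exact: Ac.
Qed.

Lemma enorm_mulmx A x : enorm x <= 1 -> enorm (A *m x) <= opnorm A.
Proof.
move=> x1; apply: ub_le_sup; last by exists x.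
(* A supremum dominates its members once the set is bounded above. On the unit ball every coordinate
   is at most 1 in absolute value, so the column norms add up to a bound. *)
exists (\sum_j enorm (col j A)) => _ [y /= y1 <-].
have -> : A *m y = \sum_j y j 0 *: col j A.
  apply/matrixP => i k; rewrite ord1 mxE summxE.
  by apply: eq_bigr => j _; rewrite !mxE mulrC.
apply: le_trans (ler_enorm_sum _ _ _) _.
apply: ler_sum => j _; rewrite enormZ ler_piMl ?enorm_ge0//.
exact: le_trans (entry_le_enorm _ _) _.
Qed.

Lemma opnorm_ge0 A : 0 <= opnorm A.
Proof.
apply: le_trans (enorm_ge0 (A *m 0)) (enorm_mulmx _ _ _).
by rewrite enorm0 ler01.
Qed.

Lemma opnormN A : opnorm (- A) = opnorm A.
Proof.
apply/eqP; rewrite eq_le; apply/andP; split; apply: ler_opnorm => x x1.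
  by rewrite mulNmx enormN enorm_mulmx.
by rewrite -enormN -mulNmx enorm_mulmx.
Qed.

Lemma ler_opnormD A B : opnorm (A + B) <= opnorm A + opnorm B.
Proof.
apply: ler_opnorm => x x1; rewrite mulmxDl.
by apply: le_trans (ler_enormD _ _) _; rewrite lerD ?enorm_mulmx.
Qed.

Lemma ler_opnormZ a A : opnorm (a *: A) <= `|a| * opnorm A.
Proof.
by apply: ler_opnorm => x x1; rewrite -scalemxAl enormZ ler_wpM2l ?enorm_mulmx.
Qed.

Lemma opnorm0 : opnorm (0 : 'M[R]_n) = 0.
Proof.
apply/le_anti; rewrite opnorm_ge0 andbT; apply: ler_opnorm => x _.
by rewrite mul0mx enorm0.
Qed.

Lemma ler_opnorm_sum (I : Type) (s : seq I) (P : pred I) (F : I -> 'M[R]_n) :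
  opnorm (\sum_(i <- s | P i) F i) <= \sum_(i <- s | P i) opnorm (F i).
Proof.
apply: (big_ind2 (fun A c => opnorm A <= c)) => //.
- by rewrite opnorm0.
- move=> A1 a1 A2 a2 h1 h2; apply: le_trans (ler_opnormD _ _) _.
  exact: lerD.
Qed.

Lemma ler_opnorm_rank1 x y : opnorm (x *m y^T) <= enorm x * enorm y.
Proof.
have dotE z : (y^T *m z) 0 0 = \sum_i y i 0 * z i 0.
  by rewrite mxE; apply: eq_bigr => i _; rewrite mxE.
apply: ler_opnorm => z z1.
rewrite -mulmxA [y^T *m z]mx11_scalar mul_mx_scalar enormZ mulrC ler_wpM2l ?enorm_ge0//.
rewrite dotE ler_norml; apply/andP; split; last first.
  by apply: le_trans (cauchy_schwarz _ _) _; rewrite ler_piMr ?enorm_ge0.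
(* The lower half of the absolute value is Cauchy-Schwarz applied to [- z]. *)
rewrite lerNl; apply: (@le_trans _ _ (\sum_i y i 0 * (- z) i 0)).
  by rewrite -sumrN; apply: ler_sum => i _; rewrite mxE mulrN.
by apply: le_trans (cauchy_schwarz _ _) _; rewrite enormN ler_piMr ?enorm_ge0.
Qed.

End Norms.

(** * The shift matrix and Schur complements *)

Section Shift.
Context {R : realType} {n : nat}.
Local Notation Z := (shiftmx R n).
Local Notation Zp := (shiftmx_pow R n).

Lemma entryE (x : 'cV[R]_n) (i : 'I_n) : entry i.+1 x = x i 0.
Proof.
rewrite /entry mxE (bigD1 i)//= big1 => [|j ji]; first by rewrite !mxE eqxx mul1r addr0.
by rewrite !mxE eqSS (inj_eq val_inj) (negPf ji) mul0r.
Qed.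

Lemma shiftmxE (i j : 'I_n) : Z i j = (i == j.+1 :> nat)%:R.
Proof.
rewrite /shiftmx summxE.
have E k : (unitv R n k.+1 *m (unitv R n k)^T) i j = ((i == k :> nat) && (j.+1 == k))%:R.
  by rewrite mxE big_ord1 !mxE eqSS -natrM mulnb.
under eq_bigr do rewrite E.
case: eqP => [ij|ij].
  (* Only the summand of index [j.+1] survives; it lies in the range because [i = j.+1] is an
     ordinal below [n]. *)
  have jn : (1 <= j.+1 < n)%N by rewrite /= -ij.
  rewrite (bigD1_seq j.+1) ?mem_index_iota ?iota_uniq//= ij !eqxx big1 ?addr0//.
  by move=> k kj; rewrite eq_sym (negPf kj).
rewrite big1// => k _; case: eqP => // ik; case: eqP => // jk.
by case: ij; rewrite ik jk.
Qed.

Lemma shiftmx_mul0 m (A : 'M[R]_(n, m)) (i : 'I_n) j : i = 0 :> nat -> (Z *m A) i j = 0.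
Proof.
move=> i0; rewrite mxE big1// => k _.
by rewrite shiftmxE i0 mul0r.
Qed.

Lemma shiftmx_mulS m (A : 'M[R]_(n, m)) (i k : 'I_n) j :
  i = k.+1 :> nat -> (Z *m A) i j = A k j.
Proof.
move=> ik; rewrite mxE (bigD1 k)//= big1 => [|l lk].
  by rewrite shiftmxE ik eqxx mul1r addr0.
rewrite shiftmxE ik eqSS.
have -> : (k == l :> nat) = false by rewrite (inj_eq val_inj) eq_sym (negPf lk).
by rewrite mul0r.
Qed.

Lemma ord_prev (i : 'I_n) : (0 < i)%N -> exists k : 'I_n, i = k.+1 :> nat.
Proof.
move=> i0; have kn : (i.-1 < n)%N by rewrite prednK// ltnW.
by exists (Ordinal kn); rewrite /= prednK.
Qed.

(** Each shift adds one leading zero row. This yields both the nilpotency of [Z] and the growing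
    zero pattern of the downdating vectors. *)
Lemma shiftmx_mul_eq0 m (A : 'M[R]_(n, m)) k j :
  (forall i : 'I_n, (i < k)%N -> A i j = 0) ->
  forall i : 'I_n, (i < k.+1)%N -> (Z *m A) i j = 0.
Proof.
move=> A0 i ik; have [i0|/ord_prev[l il]] := posnP i; first exact: shiftmx_mul0.
by rewrite (shiftmx_mulS _ _ _ _ _ il) A0// -ltnS -il.
Qed.

Lemma shiftmx_powS k : Zp k.+1 = Z *m Zp k.
Proof. exact: exprS. Qed.

Lemma shiftmx_powSr k : Zp k.+1 = Zp k *m Z.
Proof. exact: exprSr. Qed.

Lemma shiftmx_pow0 : Zp 0 = 1%:M.
Proof. exact: expr0. Qed.

Lemma shiftmx_pow_size : Zp n = 0.
Proof.
apply/matrixP => i j; rewrite [RHS]mxE.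
suff H k (l : 'I_n) : (l < k)%N -> Zp k l j = 0 by exact: H.
elim: k l => // k IH l lk; rewrite shiftmx_powS.
exact: shiftmx_mul_eq0 lk.
Qed.

Lemma ler_enorm_shift (x : 'cV[R]_n) : enorm (Z *m x) <= enorm x.
Proof.
apply: ler_enorm_sqr; rewrite !sqr_enorm.
have S0 (i : 'I_n) : i = 0 :> nat -> (Z *m x) i 0 = 0 by exact: shiftmx_mul0.
have SS (i k : 'I_n) : i = k.+1 :> nat -> (Z *m x) i 0 = x k 0.
  exact: shiftmx_mulS.
(* [Z *m x] is abstracted to a vector known only by its entries before the case split on [n]; what
   the shift loses is the last square of [x]. *)
move: (Z *m x) S0 SS => y; clear; case: n x y => [|m] x y S0 SS.
  by rewrite !big_ord0.
rewrite big_ord_recl big_ord_recr/= S0// expr0n add0r.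
rewrite (@eq_bigr _ _ _ _ _ _ _ (fun i : 'I_m => x (widen_ord (leqnSn m) i) 0 ^+ 2)).
  by rewrite lerDl sqr_ge0.
by move=> i _; rewrite (SS _ (widen_ord (leqnSn m) i)).
Qed.

Lemma ler_enorm_shiftS k (x : 'cV[R]_n) : enorm (Zp k.+1 *m x) <= enorm (Zp k *m x).
Proof. by rewrite shiftmx_powS -mulmxA ler_enorm_shift. Qed.

Lemma ler_enorm_shift_pow k (x : 'cV[R]_n) : enorm (Zp k *m x) <= enorm x.
Proof.
elim: k => [|k IH]; first by rewrite shiftmx_pow0 mul1mx.
exact: le_trans (ler_enorm_shiftS _ _) IH.
Qed.

Lemma conj_rank1 (A : 'M[R]_n) (x y : 'cV[R]_n) :
  A *m (x *m y^T) *m A^T = (A *m x) *m (A *m y)^T.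
Proof. by rewrite trmx_mul !mulmxA. Qed.

Lemma ler_opnorm_conj_rank1 k (x y : 'cV[R]_n) :
  opnorm (Zp k *m (x *m y^T) *m (Zp k)^T) <= enorm x * enorm y.
Proof.
rewrite conj_rank1; apply: le_trans (ler_opnorm_rank1 _ _) _.
by rewrite ler_pM ?enorm_ge0 ?ler_enorm_shift_pow.
Qed.

(** The sum telescopes to [A] minus its conjugate by the [n]-th power of [Z], which is zero. *)
Lemma displacement_inv (A : 'M[R]_n) :
  A = \sum_(0 <= j < n) Zp j *m (A - Z *m A *m Z^T) *m (Zp j)^T.
Proof.
have H m : \sum_(0 <= j < m) Zp j *m (A - Z *m A *m Z^T) *m (Zp j)^T
    = A - Zp m *m A *m (Zp m)^T.
  elim: m => [|m IH].
    by rewrite big_geq// shiftmx_pow0 trmx1 mulmx1 mul1mx subrr.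
  rewrite big_nat_recr//= IH mulmxBr mulmxBl addrA subrK.
  by rewrite shiftmx_powSr trmx_mul !mulmxA.
by rewrite H shiftmx_pow_size mul0mx mul0mx subr0.
Qed.

End Shift.

(** * One Schur complement step and hyperbolic rotations *)

Section Downdating.
Context {R : realType} {n : nat}.
Implicit Types (u v x : 'cV[R]_n) (S : 'M[R]_n).
Local Notation Z := (shiftmx R n).
Local Notation Zp := (shiftmx_pow R n).

(** Schur complements stay of size [n] and are padded with zero rows, so definiteness is asked only
    on vectors whose coordinates before the [k]-th vanish. For [k <= 1] this is the usual notion. *)
Definition posdef_from (k : nat) S : Prop :=
  forall x, x != 0 -> (forall i : 'I_n, (i.+1 < k)%N -> x i 0 = 0) ->
    0 < (x^T *m S *m x) 0 0.

Lemma quad_delta S (i : 'I_n) : ((delta_mx i 0 : 'cV[R]_n)^T *m S *m (delta_mx i 0 : 'cV[R]_n)) 0 0 = S i i.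
Proof. by rewrite -colE trmx_delta -rowE !mxE. Qed.

Lemma posdef_from_diag k S (i : 'I_n) : (k <= i.+1)%N -> posdef_from k S -> 0 < S i i.
Proof.
move=> ki pS; rewrite -quad_delta; apply: pS.
  apply/eqP => /matrixP /(_ i 0); rewrite !mxE !eqxx.
  by apply/eqP; rewrite oner_eq0.
move=> j jk; rewrite mxE andbT; case: eqP => // ji.
by move: jk; rewrite ji ltnNge ki.
Qed.

Section SchurStep.
(** The pivot [i0] belongs to step [k = i0.+1] of the recursion; the hypotheses describe [S_k],
    [u_k], [v_k] on entering that step. *)
Variables (i0 : 'I_n) (S : 'M[R]_n) (u v : 'cV[R]_n).
Hypothesis S_sym : S^T = S.
Hypothesis S_disp : S - Z *m S *m Z^T = u *m u^T - v *m v^T.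
Hypothesis S_pd : posdef_from i0.+1 S.
Hypothesis S_row : forall i j : 'I_n, (i < i0)%N -> S i j = 0.
Hypothesis u_supp : forall i : 'I_n, (i < i0)%N -> u i 0 = 0.
Hypothesis v_supp : forall i : 'I_n, (i < i0.+1)%N -> v i 0 = 0.

Let dispE (i j : 'I_n) : S i j = (Z *m S *m Z^T) i j + (u i 0 * u j 0 - v i 0 * v j 0).
Proof.
move: (_ *m Z^T) S_disp => W /matrixP/(_ i j).
rewrite !mxE !big_ord1 !mxE; lra.
Qed.

(** In the displacement equation, row [i0] of [Z *m S *m Z^T] comes from the zero row above the
    pivot, and [v] vanishes at [i0]. *)
Lemma schur_row (j : 'I_n) : S i0 j = u i0 0 * u j 0.
Proof.
rewrite dispE v_supp// mul0r subr0 -mulmxA.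
rewrite (@shiftmx_mul_eq0 _ _ _ _ i0) ?add0r// => i ii0.
by rewrite mxE big1// => l _; rewrite S_row// mul0r.
Qed.

Lemma schur_pivot : u i0 0 != 0.
Proof.
have := posdef_from_diag _ _ _ (leqnn _) S_pd.
by rewrite schur_row -expr2; apply: contraTN => /eqP ->; rewrite expr0n ltxx.
Qed.

(** By [schur_row], [u] is up to sign the pivot row divided by the square root of the pivot, so
    [S - u *m u^T] is the Schur complement and its pivot row is cleared. *)
Lemma schur_compl_row (i j : 'I_n) : (i < i0.+1)%N -> (S - u *m u^T) i j = 0.
Proof.
rewrite ltnS leq_eqVlt !mxE big_ord1 mxE => /orP[/eqP/val_inj ->|ii0].
  by rewrite schur_row subrr.
by rewrite S_row// u_supp// mul0r subrr.
Qed.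

(* Correcting [x] along the pivot direction makes it orthogonal to [u] without
   changing its quadratic form under the Schur complement. *)
Lemma schur_compl_posdef : posdef_from i0.+2 (S - u *m u^T).
Proof.
move=> x x0 xsupp; set S' := S - _.
pose e : 'cV[R]_n := delta_mx i0 0.
pose c := (u^T *m x) 0 0 / u i0 0.
pose y := x - c *: e.
have S'sym : S'^T = S' by rewrite /S' linearB /= trmx_mul trmxK S_sym.
have eS' : e^T *m S' = 0.
  apply/matrixP => i j; rewrite trmx_delta -rowE !mxE.
  by have := @schur_compl_row i0 j (leqnn _); rewrite !mxE.
have S'e : S' *m e = 0 by rewrite -[LHS]trmxK trmx_mul S'sym eS' trmx0.
have SE : S = S' + u *m u^T by rewrite subrK.
clearbody S'.
have uy : u^T *m y = 0.
  apply/matrixP => i j; rewrite !ord1 mulmxBr -scalemxAr -colE !mxE.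
  by rewrite -/c /c mxE divfK ?schur_pivot// subrr.
have -> : x^T *m S' *m x = y^T *m S *m y.
  rewrite SE (mulmxDr _ S') mulmxDl -!mulmxA uy !mulmx0 addr0 !mulmxA.
  have -> : y^T *m S' = x^T *m S'.
    by rewrite /y linearB linearZ /= mulmxBl -scalemxAl eS' scaler0 subr0.
  by rewrite /y mulmxBr -!mulmxA -scalemxAr S'e scaler0 mulmx0 subr0.
apply: S_pd => [|i ii0].
  (* [y] differs from [x] only at [i0], where [x] vanishes. *)
  apply: contra_neq x0 => y0; apply/matrixP => i j; rewrite ord1 [RHS]mxE.
  have [/xsupp//|ii0] := leqP i.+2 i0.+2.
  move/matrixP/(_ i 0): y0; rewrite !mxE => <-.
  have -> : (i == i0) = false by apply/negbTE/eqP => iE; rewrite iE ltnn in ii0.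
  by rewrite mulr0 subr0.
rewrite !mxE xsupp ?(ltn_trans ii0)//.
have -> : (i == i0) = false by apply/negbTE/eqP => iE; rewrite iE ltnn in ii0.
by rewrite mulr0 subr0.
Qed.

(** The diagonal entry of the Schur complement at [i1] is positive, and the displacement equation
    evaluates it to exactly [u i0 0 ^+ 2 - v i1 0 ^+ 2]. Hence the sine of the rotation is below 1
    in absolute value. *)
Lemma schur_rotation (i1 : 'I_n) : i1 = i0.+1 :> nat -> v i1 0 ^+ 2 < u i0 0 ^+ 2.
Proof.
move=> i1E; have := posdef_from_diag _ _ i1 _ schur_compl_posdef.
rewrite i1E => /(_ (leqnn _)).
have E (A B : 'M[R]_n) : (A - B) i1 i1 = A i1 i1 - B i1 i1 by rewrite !mxE.
rewrite E dispE -mulmxA (shiftmx_mulS _ _ _ _ _ i1E).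
have -> : (S *m Z^T) i0 i1 = S i0 i0.
  by rewrite -{1}S_sym -trmx_mul mxE (shiftmx_mulS _ _ _ _ _ i1E).
rewrite schur_row !mxE big_ord1 !mxE; nra.
Qed.

End SchurStep.

(** The cross terms cancel and leave a factor [1 - s ^+ 2], which the two scalings by [c^-1]
    remove. *)
Lemma hyperbolic_rotation (a b : 'cV[R]_n) (s : R) : s ^+ 2 < 1 ->
  let c := Num.sqrt (1 - s ^+ 2) in
  let a' := c^-1 *: (a - s *: b) in
  let b' := c^-1 *: (b - s *: a) in
  a' *m a'^T - b' *m b'^T = a *m a^T - b *m b^T.
Proof.
move=> s1 c a' b'.
have c2 : c ^+ 2 = 1 - s ^+ 2 by rewrite sqr_sqrtr// subr_ge0 ltW.
have c0 : c != 0 by rewrite -sqrf_eq0 c2 subr_eq0 eq_sym lt_eqF.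
apply/matrixP => i j; rewrite !mxE !big_ord1 !mxE.
apply: (mulfI (expf_neq0 2 c0)).
transitivity ((1 - s ^+ 2) * (a i 0 * a j 0 - b i 0 * b j 0)); last by rewrite c2.
by field.
Qed.


End Downdating.

(** * The exact downdating recursion *)

Section Recursion.
Context {R : realType} {n : nat}.
Variables (T : 'M[R]_n) (u v : 'cV[R]_n) (us vs : nat -> 'cV[R]_n).
Hypothesis hT : generated_by T u v.
Hypothesis hdown : downdating u v us vs.
Local Notation Z := (shiftmx R n).
Local Notation Zp := (shiftmx_pow R n).

(** Written as [T] minus a prefix, since the equality of [T] with the full sum is known only after
    the induction. *)
Let S (k : nat) : 'M[R]_n := T - \sum_(1 <= i < k) us i *m (us i)^T.

Let S_sym k : (S k)^T = S k.
Proof.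
have [[Tsym _] _ _] := hT.
rewrite linearB linear_sum /= Tsym; congr (_ - _); apply: eq_bigr => i _.
by rewrite trmx_mul trmxK.
Qed.

Let S_succ k : (0 < k)%N -> S k.+1 = S k - us k *m (us k)^T.
Proof. by move=> k0; rewrite /S big_nat_recr//= opprD addrA. Qed.

(** These are the hypotheses of the Schur step. [vs k] has one more leading zero than [us k]: the
    sine is chosen to create it. *)
Let invariant k :=
  [/\ S k - Z *m S k *m Z^T = us k *m (us k)^T - vs k *m (vs k)^T,
      posdef_from k (S k),
      forall i j : 'I_n, (i.+1 < k)%N -> S k i j = 0,
      forall i : 'I_n, (i.+1 < k)%N -> us k i 0 = 0
    & forall i : 'I_n, (i < k)%N -> vs k i 0 = 0].

Let step k : (1 <= k < n)%N -> invariant k ->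
  invariant k.+1 /\ us k.+1 *m (us k.+1)^T - vs k.+1 *m (vs k.+1)^T =
    Z *m us k *m (Z *m us k)^T - vs k *m (vs k)^T.
Proof.
case: k => // k kn [disp pd row usupp vsupp].
have [_ _ /(_ _ kn)/=] := hdown.
have k0n : (k < n)%N by apply: ltn_trans kn.
set i0 : 'I_n := Ordinal k0n.
set i1 : 'I_n := Ordinal kn.
rewrite -[k.+1]/(i0.+1) -[i0.+2]/(i1.+1) !entryE; set s := _ / _ => -[usE vsE].
have u0 : us k.+1 i0 0 != 0 by exact: (schur_pivot i0 _ _ _ disp pd row vsupp).
have s1 : s ^+ 2 < 1.
  rewrite /s exprMn exprVn ltr_pdivrMr ?mul1r; last first.
    by rewrite lt_neqAle sqr_ge0 eq_sym sqrf_eq0 u0.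
  exact: (schur_rotation i0 _ _ _ _ disp pd row usupp vsupp).
have rot : us i1.+1 *m (us i1.+1)^T - vs i1.+1 *m (vs i1.+1)^T =
    Z *m us i0.+1 *m (Z *m us i0.+1)^T - vs i0.+1 *m (vs i0.+1)^T.
  by rewrite usE vsE hyperbolic_rotation.
have combE c t (x y : 'cV[R]_n) i : (c *: (x - t *: y)) i 0 = c * (x i 0 - t * y i 0).
  by rewrite !mxE.
split=> //; split.
(* Removing [us k] from the tail replaces its rank-one term in the displacement by the shifted one,
   which is what the rotation preserves. *)
- rewrite S_succ// rot mulmxBr mulmxBl opprB addrCA conj_rank1.
  by rewrite [X in _ + X]addrAC disp [X in _ + X]addrAC subrr add0r.
- rewrite S_succ//; exact: (schur_compl_posdef i0 _ _ _ _ disp pd row usupp vsupp).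
- move=> i j ik; rewrite S_succ//.
  exact: (schur_compl_row i0 _ _ _ disp row usupp vsupp).
- move=> i ik; rewrite usE combE.
  rewrite vsupp// (@shiftmx_mul_eq0 _ _ _ _ k)//.
  by rewrite mulr0 subrr mulr0.
- move=> i; rewrite ltnS leq_eqVlt => /orP[/eqP ik|ik].
    have ii1 : i = i1 by apply: val_inj.
    (* The shifted [us] has at [i1] the pivot entry, so multiplying by the sine gives back the entry
       of [vs] and the two cancel. *)
    rewrite ii1 vsE combE.
    by rewrite (shiftmx_mulS _ _ i1 i0)// /s divfK// subrr mulr0.
  rewrite vsE combE vsupp// (@shiftmx_mul_eq0 _ _ _ _ k)//.
  by rewrite mulr0 subrr mulr0.
Qed.

Let invariantP k : (1 <= k <= n)%N -> invariant k.
Proof.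
elim: k => // -[_|k IH] kn; last first.
  by have [] := step k.+1 kn (IH (ltnW kn)).
have [[Tsym Tpd] Tdisp v1] := hT.
have [us1 vs1 _] := hdown.
split; rewrite ?us1 ?vs1 // /S ?big_geq// ?subr0//.
- by move=> x x0 _; exact: Tpd.
- move=> i; rewrite ltnS leqn0 => /eqP i0.
  (* The generator condition concerns the product of [v^T] with the unit vector, [entry] its
     transpose. *)
  by rewrite -entryE i0 /entry -[LHS]/((_ *m _) 0 0) -[_ *m _]trmxK trmx_mul trmxK mxE.
Qed.

(** At [k = n] one last Schur complement, with no rotation after it, clears the only row not yet
    known to vanish, so nothing of [T] remains. *)
Lemma downdating_gram : (0 < n)%N -> T = \sum_(1 <= i < n.+1) us i *m (us i)^T.
Proof.
move=> n0; have n1 : (n.-1 < n)%N by rewrite prednK.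
set i := Ordinal n1; have iE : i.+1 = n by exact: prednK.
suff S0 : S i.+2 = 0 by move/subr0_eq: S0; rewrite iE.
have [|disp pd row usupp vsupp] := invariantP i.+1; first by rewrite iE n0 leqnn.
rewrite S_succ//; apply/matrixP => j l; rewrite [RHS]mxE.
by apply: (schur_compl_row i _ _ _ disp row usupp vsupp); rewrite iE.
Qed.

(** With [downdating_last_u], this makes the end terms of the perturbed recursion quadratic in the
    errors. *)
Lemma downdating_last_v : (0 < n)%N -> vs n = 0.
Proof.
move=> n0; have := invariantP n; rewrite n0 leqnn => /(_ isT)[_ _ _ _ vsupp].
by apply/matrixP => i j; rewrite ord1 [RHS]mxE vsupp.
Qed.

Lemma downdating_last_u : (0 < n)%N -> Z *m us n = 0.
Proof.
move=> n0; have := invariantP n; rewrite n0 leqnn => /(_ isT)[_ _ _ usupp _].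
apply/matrixP => i j; rewrite ord1 [RHS]mxE.
apply: (shiftmx_mul_eq0 _ _ n.-1) => [l ln|]; last by rewrite prednK.
by apply: usupp; lia.
Qed.

Lemma downdating_disp k : (1 <= k <= n)%N ->
  us k *m (us k)^T - vs k *m (vs k)^T = S k - Z *m S k *m Z^T.
Proof. by move=> /invariantP[->]. Qed.

(* The trace of [Zp j *m (S k - Z *m S k *m Z^T) *m (Zp j)^T] is nonnegative,
   because the shift contracts the norm and [S k] is the tail of the Gram sum. *)
Lemma downdating_norm_le j k : (1 <= k <= n)%N ->
  enorm (Zp j *m vs k) <= enorm (Zp j *m us k).
Proof.
move=> /[dup] kn /andP[k0 kn'].
have SE : S k = \sum_(k <= i < n.+1) us i *m (us i)^T.
  rewrite /S {1}downdating_gram ?(leq_trans k0)//.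
  by rewrite (@big_cat_nat _ _ _ k)//= 1?ltnW// addrAC subrr add0r.
apply: ler_enorm_sqr; rewrite -subr_ge0 -!mxtrace_sqr_enorm -!conj_rank1.
rewrite -linearB /= -mulmxBl -mulmxBr downdating_disp// mulmxBr mulmxBl.
rewrite !mulmxA -shiftmx_powSr -!mulmxA -trmx_mul -shiftmx_powSr !mulmxA.
rewrite SE !mulmx_sumr !mulmx_suml -sumrB linear_sum /= sumr_ge0// => i _.
rewrite linearB /= !conj_rank1 !mxtrace_sqr_enorm subr_ge0.
by rewrite ler_sqr ?nnegrE ?enorm_ge0// ler_enorm_shiftS.
Qed.

(** Allows the error in [v] to be charged to the norm of [u] alone. *)
Lemma generators_norm_le : (0 < n)%N -> enorm v <= enorm u.
Proof.
move=> n0; have [us1 vs1 _] := hdown.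
by have := downdating_norm_le 0 1; rewrite us1 vs1 shiftmx_pow0 !mul1mx; apply.
Qed.

Lemma downdating_mxtrace j : (0 < n)%N ->
  \tr (Zp j *m T *m (Zp j)^T) = \sum_(1 <= i < n.+1) enorm (Zp j *m us i) ^+ 2.
Proof.
move=> n0; rewrite (downdating_gram n0) mulmx_sumr mulmx_suml linear_sum /=.
by apply: eq_bigr => i _; rewrite conj_rank1 mxtrace_sqr_enorm.
Qed.

(* Each of the four terms of the hypothesis on [G k] contributes one trace. *)
Lemma downdating_norm_sum j : (0 < n)%N ->
  \sum_(1 <= k < n) (enorm (Zp j.+1 *m us k) ^+ 2 + enorm (Zp j *m vs k) ^+ 2
    + enorm (Zp j *m us k.+1) ^+ 2 + enorm (Zp j *m vs k.+1) ^+ 2)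
  <= 4 * \tr (Zp j *m T *m (Zp j)^T).
Proof.
move=> n0; rewrite downdating_mxtrace//.
set F := fun i => enorm (Zp j *m us i) ^+ 2.
have F0 i : 0 <= F i by exact: sqr_ge0.
have h1 : \sum_(1 <= k < n) F k <= \sum_(1 <= k < n.+1) F k.
  by rewrite [leRHS]big_nat_recr//= lerDl.
have h2 : \sum_(1 <= k < n) F k.+1 <= \sum_(1 <= k < n.+1) F k.
  by rewrite [leRHS]big_nat_recl//= lerDr.
(* The shift contracts norms and [vs] is dominated by [us], so each term is at most [F k] or
   [F k.+1]. *)
apply: (@le_trans _ _ (\sum_(1 <= k < n) (F k + F k + F k.+1 + F k.+1))).
  apply: ler_sum_nat => k /andP[k0 kn].
  rewrite !lerD// ler_sqr ?nnegrE ?enorm_ge0 ?ler_enorm_shiftS//.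
    by rewrite downdating_norm_le// k0 ltnW.
  by rewrite downdating_norm_le.
rewrite !big_split /=; move: h1 h2; lra.
Qed.

End Recursion.

(** * The perturbed recursion *)

Section Perturbation.
Context {R : realType} {n : nat}.
Local Notation Z := (shiftmx R n).
Local Notation Zp := (shiftmx_pow R n).

Lemma gram_rows (x : nat -> 'cV[R]_n) :
  let X := \sum_(1 <= k < n.+1) unitv R n k *m (x k)^T in
  X^T *m X = \sum_(1 <= k < n.+1) x k *m (x k)^T.
Proof.
move=> X.
have XE (i j : 'I_n) : X i j = x i.+1 j 0.
  rewrite /X summxE (bigD1_seq i.+1) ?mem_index_iota ?iota_uniq ?ltnS ?ltn_ord//=.
  rewrite mxE big_ord1 !mxE eqxx mul1r big1 ?addr0// => k ki.
  by rewrite mxE big_ord1 !mxE eq_sym (negPf ki) mul0r.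
apply/matrixP => a b; rewrite mxE summxE big_add1 big_mkord.
by apply: eq_bigr => i _; rewrite mxE !XE mxE big_ord1 mxE.
Qed.

(** Each elementary matrix is a rank-one product of unit vectors, so its conjugate has norm at most
    1. The bound is uniform in [j] and converts the entrywise remainder into a norm. *)
Lemma ler_opnorm_entries j (A : 'M[R]_n) :
  opnorm (Zp j *m A *m (Zp j)^T) <= \sum_a \sum_b `|A a b|.
Proof.
rewrite {1}(matrix_sum_delta A) mulmx_sumr mulmx_suml.
apply: le_trans (ler_opnorm_sum _ _ _ _) _; apply: ler_sum => a _.
rewrite mulmx_sumr mulmx_suml.
apply: le_trans (ler_opnorm_sum _ _ _ _) _; apply: ler_sum => b _.
rewrite -scalemxAr -scalemxAl; apply: le_trans (ler_opnormZ _ _) _.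
rewrite ler_piMr//.
have -> : delta_mx a b = delta_mx a 0 *m (delta_mx b 0 : 'cV[R]_n)^T :> 'M[R]_n.
  by rewrite trmx_delta mul_delta_mx.
apply: le_trans (ler_opnorm_conj_rank1 _ _ _) _.
by rewrite mulr_ile1 ?enorm_ge0 ?enorm_delta_le1.
Qed.

(** With [d = y - x], the difference is minus the sum of the two cross products of [x] and [d], of
    first order, and the square of [d]. *)
Lemma ler_opnorm_rank1_diff j (x y : 'cV[R]_n) :
  opnorm (Zp j *m (x *m x^T - y *m y^T) *m (Zp j)^T)
  <= 2 * enorm x * enorm (y - x) + enorm (y - x) ^+ 2.
Proof.
set d := y - x.
have -> : y = x + d by rewrite addrC subrK.
clearbody d; have -> : x *m x^T - (x + d) *m (x + d)^T = - (x *m d^T + d *m x^T + d *m d^T).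
  by rewrite linearD /= mulmxDl !mulmxDr !opprD !addrA subrr add0r.
rewrite mulmxN mulNmx opnormN !mulmxDr !mulmxDl.
have xd := ler_opnorm_conj_rank1 j x d; have dx := ler_opnorm_conj_rank1 j d x.
have dd := ler_opnorm_conj_rank1 j d d.
apply: le_trans (ler_opnormD _ _) _.
apply: (@le_trans _ _ (enorm x * enorm d + enorm d * enorm x + enorm d * enorm d)).
  exact: lerD (le_trans (ler_opnormD _ _) (lerD xd dx)) dd.
by lra.
Qed.

(** When the relation is summed over [k], the shifted terms of [x] and the terms of [y] cancel
    except at the two ends [k = 1] and [k = n]. *)
Lemma perturbed_disp (T : 'M[R]_n) (u v : 'cV[R]_n) (x y : nat -> 'cV[R]_n)
    (H : nat -> 'M[R]_n) (n_gt0 : (0 < n)%N) :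
  T - Z *m T *m Z^T = u *m u^T - v *m v^T ->
  (forall k, (1 <= k < n)%N ->
    x k.+1 *m (x k.+1)^T - y k.+1 *m (y k.+1)^T =
    Z *m x k *m (x k)^T *m Z^T - y k *m (y k)^T + H k) ->
  let D := T - \sum_(1 <= k < n.+1) x k *m (x k)^T in
  D - Z *m D *m Z^T =
    (u *m u^T - x 1%N *m (x 1%N)^T) - (v *m v^T - y 1%N *m (y 1%N)^T)
    - y n *m (y n)^T + (Z *m x n) *m (Z *m x n)^T - \sum_(1 <= k < n) H k.
Proof.
move=> Tdisp rel D.
pose X k := x k *m (x k)^T; pose Y k := y k *m (y k)^T.
have XZ : Z *m (\sum_(1 <= k < n.+1) X k) *m Z^T =
    \sum_(1 <= k < n) Z *m X k *m Z^T + Z *m X n *m Z^T.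
  by rewrite mulmx_sumr mulmx_suml big_nat_recr.
have X1 : \sum_(1 <= k < n.+1) X k = X 1%N + \sum_(1 <= k < n) X k.+1.
  by rewrite big_nat_recl.
have Y1 : Y 1%N + \sum_(1 <= k < n) Y k.+1 = \sum_(1 <= k < n) Y k + Y n.
  by rewrite -big_nat_recl// big_nat_recr.
have rels : \sum_(1 <= k < n) X k.+1 - \sum_(1 <= k < n) Y k.+1 =
    \sum_(1 <= k < n) Z *m X k *m Z^T - \sum_(1 <= k < n) Y k + \sum_(1 <= k < n) H k.
  rewrite -!sumrB -big_split; apply: eq_big_nat => k kn /=.
  by rewrite rel// !mulmxA.
rewrite /D mulmxBr mulmxBl XZ X1 -conj_rank1 -/(X 1%N) -/(X n) -/(Y 1%N) -/(Y n).
move: Tdisp Y1 rels.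
(* All blocks become variables, which leaves an identity linear in their entries. *)
move: (Z *m T *m Z^T) (Z *m X n *m Z^T) (u *m u^T) (v *m v^T) (X 1%N) (Y 1%N) (Y n)
  => ZT ZX uu vv x1 y1 yn.
move: (\sum_(1 <= k < n) X k.+1) (\sum_(1 <= k < n) Y k.+1) (\sum_(1 <= k < n) Y k)
  (\sum_(1 <= k < n) Z *m X k *m Z^T) (\sum_(1 <= k < n) H k) => sx sy sy' sz sh.
move=> /matrixP e1 /matrixP e2 /matrixP e3; apply/matrixP => i j.
move: (e1 i j) (e2 i j) (e3 i j); rewrite !mxE; lra.
Qed.

(** The non-asymptotic form at a fixed [eps], with an explicit remainder: the [n] conjugates in
    [displacement_inv] are bounded one by one. *)
Lemma perturbed_gram_bound (T : 'M[R]_n) (u v : 'cV[R]_n)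
    (us vs x y : nat -> 'cV[R]_n) (G E : nat -> 'M[R]_n) (eps cm : R) :
  (0 < n)%N -> 0 <= eps -> 0 <= cm ->
  generated_by T u v -> downdating u v us vs ->
  (forall k, (1 <= k < n)%N ->
    x k.+1 *m (x k.+1)^T - y k.+1 *m (y k.+1)^T =
    Z *m x k *m (x k)^T *m Z^T - y k *m (y k)^T + eps *: G k + E k) ->
  (forall k j, (1 <= k < n)%N -> (j < n)%N ->
    opnorm (Zp j *m G k *m (Zp j)^T) <=
    cm * (enorm (Zp j.+1 *m us k) ^+ 2 + enorm (Zp j *m vs k) ^+ 2
      + enorm (Zp j *m us k.+1) ^+ 2 + enorm (Zp j *m vs k.+1) ^+ 2)) ->
  opnorm (T - \sum_(1 <= k < n.+1) x k *m (x k)^T) <=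
    2 * n%:R * enorm u * (enorm (x 1%N - u) + enorm (y 1%N - v))
    + 4 * eps * cm * (\sum_(0 <= j < n) \tr (Zp j *m T *m (Zp j)^T))
    + n%:R * (enorm (x 1%N - u) ^+ 2 + enorm (y 1%N - v) ^+ 2
        + enorm (x n - us n) ^+ 2 + enorm (y n - vs n) ^+ 2
        + \sum_(1 <= k < n) \sum_a \sum_b `|E k a b|).
Proof.
move=> n0 eps0 cm0 hT hdown rel hG; have [_ Tdisp _] := hT.
set D := T - _.
have DE := perturbed_disp _ _ _ _ y (fun k => eps *: G k + E k) n0 Tdisp.
have {DE}/= DE := DE x (fun k kn => etrans (rel k kn) (esym (addrA _ _ _))).
set du := enorm (x 1%N - u); set dv := enorm (y 1%N - v).
set B := \sum_(1 <= k < n) \sum_a _.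
have vu : enorm v <= enorm u by exact: (generators_norm_le _ _ _ _ _ hT hdown).
have yn : enorm (y n) ^+ 2 = enorm (y n - vs n) ^+ 2.
  by rewrite (downdating_last_v _ _ _ _ _ hT hdown)// subr0.
have xn : enorm (Z *m x n) <= enorm (x n - us n).
  apply: le_trans (ler_enorm_shift _).
  by rewrite mulmxBr (downdating_last_u _ _ _ _ _ hT hdown)// subr0.
(* The first term comes from the initial errors, the second from the [G k]; the rest is of second
   order. *)
pose c j := 2 * enorm u * (du + dv) + eps * cm * (4 * \tr (Zp j *m T *m (Zp j)^T))
  + (du ^+ 2 + dv ^+ 2 + enorm (x n - us n) ^+ 2 + enorm (y n - vs n) ^+ 2 + B).
suff H j : (j < n)%N -> opnorm (Zp j *m (D - Z *m D *m Z^T) *m (Zp j)^T) <= c j.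
  rewrite (displacement_inv D); apply: le_trans (ler_opnorm_sum _ _ _ _) _.
  apply: (@le_trans _ _ (\sum_(0 <= j < n) c j)).
    by apply: ler_sum_nat => j /andP[_ jn]; exact: H.
  have sum_c (a b r : R) (f : nat -> R) :
      \sum_(0 <= j < n) (a + b * f j + r) = n%:R * a + b * (\sum_(0 <= j < n) f j) + n%:R * r.
    by rewrite 2!big_split /= !sumr_const_nat subn0 -mulr_sumr !mulr_natl.
  rewrite sum_c -mulr_sumr le_eqVlt; apply/orP; left; apply/eqP.
  by ring.
move=> jn; rewrite DE.
have GE : opnorm (Zp j *m (\sum_(1 <= k < n) (eps *: G k + E k)) *m (Zp j)^T) <=
    eps * cm * (4 * \tr (Zp j *m T *m (Zp j)^T)) + B.
  rewrite big_split /= mulmxDr mulmxDl; apply: le_trans (ler_opnormD _ _) _.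
  apply: lerD; rewrite mulmx_sumr mulmx_suml.
    apply: le_trans (ler_opnorm_sum _ _ _ _) _.
    rewrite -mulrA; apply: (@le_trans _ _ (eps * (cm * \sum_(1 <= k < n)
      (enorm (Zp j.+1 *m us k) ^+ 2 + enorm (Zp j *m vs k) ^+ 2
      + enorm (Zp j *m us k.+1) ^+ 2 + enorm (Zp j *m vs k.+1) ^+ 2)))).
      rewrite !mulr_sumr; apply: ler_sum_nat => k kn.
      rewrite -scalemxAr -scalemxAl; apply: le_trans (ler_opnormZ _ _) _.
      by rewrite ger0_norm// ler_wpM2l// hG.
    do 2 rewrite ler_wpM2l//.
    exact: (downdating_norm_sum _ _ _ _ _ hT hdown).
  apply: le_trans (ler_opnorm_sum _ _ _ _) _.
  by apply: ler_sum => k _; exact: ler_opnorm_entries.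
have UE := ler_opnorm_rank1_diff j u (x 1%N).
have VE := ler_opnorm_rank1_diff j v (y 1%N).
have YE := ler_opnorm_conj_rank1 j (y n) (y n).
have XE := ler_opnorm_conj_rank1 j (Z *m x n) (Z *m x n).
rewrite -expr2 in XE; rewrite -expr2 yn in YE.
have XE2 : enorm (Z *m x n) ^+ 2 <= enorm (x n - us n) ^+ 2.
  by rewrite ler_sqr ?nnegrE ?enorm_ge0.
have VE2 : 2 * enorm v * dv <= 2 * enorm u * dv.
  by rewrite ler_wpM2r ?enorm_ge0// ler_wpM2l.
have conj5 (A1 A2 A3 A4 A5 : 'M[R]_n) :
    opnorm (Zp j *m (A1 - A2 - A3 + A4 - A5) *m (Zp j)^T) <=
      opnorm (Zp j *m A1 *m (Zp j)^T) + opnorm (Zp j *m A2 *m (Zp j)^T)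
      + opnorm (Zp j *m A3 *m (Zp j)^T) + opnorm (Zp j *m A4 *m (Zp j)^T)
      + opnorm (Zp j *m A5 *m (Zp j)^T).
  have N (M1 M2 : 'M[R]_n) : opnorm (M1 - M2) <= opnorm M1 + opnorm M2.
    by rewrite -(opnormN M2) ler_opnormD.
  rewrite !(mulmxBr, mulmxDr) !(mulmxBl, mulmxDl) !mulNmx.
  apply: le_trans (N _ _) _; rewrite lerD2r.
  apply: le_trans (ler_opnormD _ _) _; rewrite lerD2r.
  by apply: le_trans (N _ _) _; rewrite lerD2r N.
apply: le_trans (conj5 _ _ _ _ _) _.
apply: le_trans (lerD (lerD (lerD (lerD UE VE) YE) XE) GE) _.
move: XE2 VE2; rewrite /c -/du -/dv.
move: (enorm (Z *m _) ^+ 2) (enorm (x n - _) ^+ 2) (enorm (y n - _) ^+ 2) => zx xx yy.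
move: (\tr _) (du) (dv) (B) (enorm u) (enorm v) (eps) (cm) => t a b s p q e m.
clear; lra.
Qed.

End Perturbation.

(** * Remainder terms *)

Section QuadraticBigO.
Context {R : realType}.
Local Notation sq := (fun eps : R => eps ^+ 2).

Lemma sqr_bigO (f : R -> R) :
  f =O_ ((0 : R)^'+) (fun eps : R => eps) ->
  (fun eps => f eps ^+ 2) =O_ ((0 : R)^'+) sq.
Proof.
move=> /eqO_exP[k k0 fk]; apply/eqO_exP; exists (k ^+ 2); first exact: exprn_gt0.
near=> e; rewrite !normrX -exprMn ler_sqr ?nnegrE ?mulr_ge0 ?(ltW k0)//.
by near: e.
Unshelve. all: by end_near. Qed.

Lemma add_bigO (f g h : R -> R) :
  f =O_ ((0 : R)^'+) h -> g =O_ ((0 : R)^'+) h ->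
  (fun eps => f eps + g eps) =O_ ((0 : R)^'+) h.
Proof.
move=> /eqO_exP[k k0 fk] /eqO_exP[l l0 gl]; apply/eqO_exP.
exists (k + l); first exact: addr_gt0.
near=> e; apply: le_trans (ler_normD _ _) _; rewrite mulrDl lerD//.
  by near: e.
by near: e.
Unshelve. all: by end_near. Qed.

Lemma sum_bigO (I : eqType) (s : seq I) (f : I -> R -> R) (h : R -> R) :
  (forall i, i \in s -> f i =O_ ((0 : R)^'+) h) ->
  (fun eps => \sum_(i <- s) f i eps) =O_ ((0 : R)^'+) h.
Proof.
elim: s => [_|i s IH fs].
  apply/eqO_exP; exists 1 => //; near=> e.
  by rewrite big_nil normr0 mul1r.
under eq_fun do rewrite big_cons.
apply: add_bigO; first by apply: fs; rewrite mem_head.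
by apply: IH => l ls; apply: fs; rewrite in_cons ls orbT.
Unshelve. all: by end_near. Qed.

Lemma scale_bigO (c : R) (f h : R -> R) :
  f =O_ ((0 : R)^'+) h -> (fun eps => c * f eps) =O_ ((0 : R)^'+) h.
Proof.
move=> /eqO_exP[k k0 fk]; apply/eqO_exP; exists ((`|c| + 1) * k).
  by rewrite mulr_gt0// ltr_wpDl.
near=> e; rewrite normrM -mulrA ler_pM// ?lerDl//.
by near: e.
Unshelve. all: by end_near. Qed.

(** Turns a remainder relative to the norm of [G k] into a plain second-order one. The 1 in
    [|C| + 1] keeps the constant positive. *)
Lemma bounded_factor_bigO (f g h : R -> R) (C : R) :
  f =O_ ((0 : R)^'+) (fun eps => h eps * g eps) ->
  (\forall eps \near (0 : R)^'+, `|g eps| <= C) ->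
  (fun eps => `|f eps|) =O_ ((0 : R)^'+) h.
Proof.
move=> /eqO_exP[k k0 fk] gC; apply/eqO_exP; exists (k * (`|C| + 1)).
  by rewrite mulr_gt0// ltr_wpDl.
near=> e; rewrite normr_id; apply: (@le_trans _ _ (k * `|h e * g e|)).
  by near: e.
rewrite -mulrA ler_wpM2l ?(ltW k0)// normrM mulrC ler_wpM2r//.
apply: (@le_trans _ _ C); first by near: e.
by rewrite (le_trans (ler_norm _))// lerDl.
Unshelve. all: by end_near. Qed.

End QuadraticBigO.

Theorem theorem5p1 (R : realType) (n : nat) (T : 'M[R]_n) (u v : 'cV[R]_n)
    (us vs : nat -> 'cV[R]_n)
    (ut vt : nat -> R -> 'cV[R]_n)
    (G E : nat -> R -> 'M[R]_n) (cm : R)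
    (n_gt0 : (0 < n)%N)
    (hT : generated_by T u v)
    (hdown : downdating u v us vs)
    (hut : forall k : nat, (1 <= k <= n)%N ->
       (fun eps : R => enorm (ut k eps - us k)) =O_ ((0 : R)^'+) (fun eps : R => eps))
    (hvt : forall k : nat, (1 <= k <= n)%N ->
       (fun eps : R => enorm (vt k eps - vs k)) =O_ ((0 : R)^'+) (fun eps : R => eps))
    (hrel : \forall eps \near (0 : R)^'+, forall k : nat, (1 <= k < n)%N ->
       ut k.+1 eps *m (ut k.+1 eps)^T - vt k.+1 eps *m (vt k.+1 eps)^T =
       shiftmx R n *m ut k eps *m (ut k eps)^T *m (shiftmx R n)^T
         - vt k eps *m (vt k eps)^T + eps *: G k eps + E k eps)
    (hE : forall (k : nat) (a b : 'I_n), (1 <= k < n)%N ->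
       (fun eps : R => E k eps a b)
         =O_ ((0 : R)^'+) (fun eps : R => eps ^+ 2 * opnorm (G k eps)))
    (cm_gt0 : 0 < cm)
    (hG : \forall eps \near (0 : R)^'+, forall k j : nat,
       (1 <= k < n)%N -> (j < n)%N ->
       opnorm (shiftmx_pow R n j *m G k eps *m (shiftmx_pow R n j)^T) <=
       cm * (enorm (shiftmx_pow R n j.+1 *m us k) ^+ 2
             + enorm (shiftmx_pow R n j *m vs k) ^+ 2
             + enorm (shiftmx_pow R n j *m us k.+1) ^+ 2
             + enorm (shiftmx_pow R n j *m vs k.+1) ^+ 2)) :
  let Ut := fun eps : R => \sum_(1 <= k < n.+1) unitv R n k *m (ut k eps)^T in
  exists2 r : R -> R, r =O_ ((0 : R)^'+) (fun eps : R => eps ^+ 2) &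
    \forall eps \near (0 : R)^'+,
      opnorm (T - (Ut eps)^T *m Ut eps) <=
      2 * n%:R * enorm u * (enorm (ut 1%N eps - u) + enorm (vt 1%N eps - v))
      + 4 * eps * cm
          * (\sum_(0 <= j < n) \tr (shiftmx_pow R n j *m T *m (shiftmx_pow R n j)^T))
      + r eps.
Proof.
move=> Ut; have [us1 vs1 _] := hdown.
(* The witness is the explicit remainder of [perturbed_gram_bound]. *)
exists (fun eps => n%:R * (enorm (ut 1%N eps - u) ^+ 2 + enorm (vt 1%N eps - v) ^+ 2
    + enorm (ut n eps - us n) ^+ 2 + enorm (vt n eps - vs n) ^+ 2
    + \sum_(1 <= k < n) \sum_a \sum_b `|E k eps a b|)).
  apply: scale_bigO.
  have hE2 : (fun eps => \sum_(1 <= k < n) \sum_a \sum_b `|E k eps a b|)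
      =O_ ((0 : R)^'+) (fun eps : R => eps ^+ 2).
    apply: sum_bigO => k; rewrite mem_index_iota => kn.
    apply: sum_bigO => a _; apply: sum_bigO => b _.
    apply: bounded_factor_bigO (hE k a b kn) _.
    (* At [j = 0] the conjugation is trivial, so the hypothesis bounds the norm of [G k] by a
       quantity free of [eps]. *)
    apply: filterS hG => e /(_ k 0%N kn n_gt0).
    by rewrite shiftmx_pow0 mul1mx trmx1 mulmx1 ger0_norm ?opnorm_ge0//; exact.
  apply: add_bigO hE2; apply: add_bigO; last by apply: sqr_bigO; apply: hvt; rewrite n_gt0 /=.
  apply: add_bigO; last by apply: sqr_bigO; apply: hut; rewrite n_gt0 /=.
  apply: add_bigO; apply: sqr_bigO.
    by rewrite -us1; exact: hut.
  by rewrite -vs1; exact: hvt.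
near=> e; rewrite /Ut gram_rows.
apply: (perturbed_gram_bound _ _ _ us vs _ (fun k => vt k e) (fun k => G k e)) => //.
- exact: ltW.
- by near: e.
- by near: e.
Unshelve. all: by end_near. Qed.
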